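(* Let $A\colon\mathcal{X}\to 2^{\mathcal{X}^*}$, let $\varnothing\neq\mathcal{D}\subset\mathcal{X}$, let $W\colon\mathcal{D}\to\mathcal{X}^*$, let $x\in\mathcal{D}$, let $u^*\in\mathcal{X}^*$, let $\gamma\in\,]0,+\infty[$, let $\alpha\in\,]0,+\infty[$, and let $\beta\in\,]0,+\infty[$. Suppose that $\mathcal{D}\cap\operatorname{dom}A\neq\varnothing$, that $W$ is $(\alpha,\beta)$-jointly strongly monotone, and that one of the following properties (E1)--(E9) is satisfied: (E1) $Wx+\gamma u^*\in\operatorname{ran}(W+\gamma A)$. (E2) $W+\gamma A$ is surjective. (E3) $W+\gamma A$ is maximally monotone and $(W+\gamma A)^{-1}$ is locally bounded at every point in $\mathcal{X}^*$. (E4) $W+\gamma A$ is maximally monotone and either (a) $\operatorname{dom}W\cap\operatorname{dom}A$ is bounded, or (b) $\operatorname{dom}W\cap\operatorname{dom}A$ is unbounded and $\inf_{y^*\in Wy+\gamma Ay}\|y^*\|\to+\infty$ as $\|y\|\to+\infty$ with $y\in\operatorname{dom}W\cap\operatorname{dom}A$. (E5) $W+\gamma A$ is maximally monotone and $\phi$-uniformly monotone with $\phi(t)/t\to+\infty$ as $t\to+\infty$. (E6) $W+\gamma A$ is maximally monotone and $\rho$-strongly monotone for some $\rho\in\,]0,+\infty[$. (E7) $W$ and $A$ are monotone, $W+\gamma A$ is maximally monotone, $\operatorname{ran}W+\gamma\operatorname{ran}A=\mathcal{X}^*$, and one of the following is satisfied: (a) $W$ and $A$ are $3^*$ monotone;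 (b) $W$ is $3^*$ monotone and $\operatorname{dom}A\subset\operatorname{dom}W$; (c) $A$ is $3^*$ monotone and $\operatorname{dom}W\subset\operatorname{dom}A$. (E8) $W=\partial f$ with $f\in\Gamma_0(\mathcal{X})$, $A$ is monotone, $\partial f+\gamma A$ is maximally monotone, $\operatorname{dom}\partial f^*+\gamma\operatorname{ran}A=\mathcal{X}^*$, and either $\operatorname{dom}A\subset\operatorname{dom}\partial f$ or $A$ is $3^*$ monotone. (E9) $W$ and $A$ are monotone, $W+\gamma A$ is maximally monotone, and either (a) $W$ is $3^*$ monotone and surjective, or (b) $A$ is $3^*$ monotone and surjective. Suppose also that one of the following is satisfied: (i) $W+\gamma A$ is injective. (ii) $W+\gamma A$ is strictly monotone. (iii) $W$ is uniformly monotone and $A$ is monotone. Then $J_{\gamma(A-u^* )}^Wx$ is a singleton and, setting $z=J_{\gamma(A-u^* )}^Wx$, $$H_A(x,u^* )\geq\frac{\langle x-z,Wx-Wz\rangle}{\gamma}\geq\frac{\min\{\alpha,\beta\}}{2}d^2_{\operatorname{gra}A,\gamma}(x,u^* ).$$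
   Context: $\mathcal{X}\neq\{0\}$ is a reflexive real Banach space with topological dual $\mathcal{X}^*$, and $\langle\cdot,\cdot\rangle$ is the canonical duality pairing. For $A\colon\mathcal{X}\to 2^{\mathcal{X}^*}$: $\operatorname{gra}A=\{(x,x^* )\mid x^*\in Ax\}$, $\operatorname{dom}A=\{x\mid Ax\neq\varnothing\}$, $\operatorname{ran}A=\bigcup_xAx$, $A^{-1}x^*=\{x\mid x^*\in Ax\}$; images of sets and compositions are unions of images; $A$ is surjective if $\operatorname{ran}A=\mathcal{X}^*$. A map $W\colon\mathcal{D}\to\mathcal{X}^*$ is identified with the set-valued operator equal to $\{Wx\}$ for $x\in\mathcal{D}$ and $\varnothing$ otherwise, so $\operatorname{dom}W=\mathcal{D}$. The Haraux function is $H_A\colon\mathcal{X}\times\mathcal{X}^*\to[-\infty,+\infty]\colon(x,u^* )\mapsto\sup_{(y,y^* )\in\operatorname{gra}A}\langle x-y,y^*-u^*\rangle$, and $\operatorname{dom}H_A=\{H_A<+\infty\}$. $\gamma(A-u^* )$ is the operator $x\mapsto\{\gamma(x^*-u^* )\mid x^*\in Ax\}$. The warped resolvent of $A$ with kernel $K\colon\mathcal{X}\to2^{\mathcal{X}^*}$ is $J_A^K=(K+A)^{-1}\circ K$; a singleton value is identified with its element. $A$ is monotone if $\langle x-y,x^*-y^*\rangle\geq0$ for all $(x,x^* ),(y,y^* )\in\operatorname{gra}A$, strictly monotone if moreover the inequality is strict whenever $x\neq y$, and maximally monotone if, for every $(x,x^* )\in\mathcal{X}\times\mathcal{X}^*$,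 $(x,x^* )\in\operatorname{gra}A$ iff $\langle x-y,x^*-y^*\rangle\geq0$ for every $(y,y^* )\in\operatorname{gra}A$. $A$ is $\phi$-uniformly monotone, where $\phi\colon[0,+\infty[\,\to[0,+\infty]$ is increasing and vanishes only at $0$, if $\langle x-y,x^*-y^*\rangle\geq\phi(\|x-y\|)$ for all $(x,x^* ),(y,y^* )\in\operatorname{gra}A$; uniformly monotone means $\phi$-uniformly monotone for some such $\phi$; $\rho$-strongly monotone ($\rho>0$) is the case $\phi=\rho|\cdot|^2$. $A$ is $3^*$ monotone if it is monotone and $\operatorname{dom}A\times\operatorname{ran}A\subset\operatorname{dom}H_A$. $A$ is injective if $Ax\cap Ay\neq\varnothing$ implies $x=y$. $W\colon\mathcal{D}\to\mathcal{X}^*$ is $(\alpha,\beta)$-jointly strongly monotone if $\langle x-y,Wx-Wy\rangle\geq\frac{\alpha}{2}\|x-y\|^2+\frac{\beta}{2}\|Wx-Wy\|^2$ for all $x,y\in\mathcal{D}$. $\Gamma_0(\mathcal{X})$ is the class of proper lower semicontinuous convex functions from $\mathcal{X}$ to $]-\infty,+\infty]$; $\partial f$ denotes the subdifferential of $f$ and $f^*\colon x^*\mapsto\sup_{x\in\mathcal{X}}(\langle x,x^*\rangle-f(x))$ its conjugate. For $\gamma\in\,]0,+\infty[$, set $|||(x,x^* )|||_\gamma=\sqrt{\|x\|^2/\gamma+\gamma\|x^*\|^2}$ for $(x,x^* )\in\mathcal{X}\times\mathcal{X}^*$, and for $\boldsymbol{C}\subset\mathcal{X}\times\mathcal{X}^*$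 set $d_{\boldsymbol{C},\gamma}(x,x^* )=\inf_{(y,y^* )\in\boldsymbol{C}}|||(x,x^* )-(y,y^* )|||_\gamma\in[0,+\infty]$. *)

(* Defs.v *)
From HB Require Import structures.
From mathcomp Require Import all_boot all_order all_algebra.
From mathcomp Require Import all_classical all_reals all_analysis.
Import numFieldNormedType.Exports.
Import Order.TTheory GRing.Theory Num.Theory.

Set Implicit Arguments.
Unset Strict Implicit.
Unset Printing Implicit Defensive.

Local Open Scope classical_set_scope.
Local Open Scope ring_scope.

Set Warnings "-redundant-canonical-projection,-projection-no-head-constant".

Section dual_space.
Context {R : realType} {X : normedModType R}.

Definition dual_pred : {pred (X -> R^o)} :=
  fun f => `[< scalar f /\ continuous f >].

Lemma dual_submod_closed : submod_closed dual_pred.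
Proof.
split.
  rewrite unfold_in; apply/asboolP; split; last by move=> x; exact: cvg_cst.
  by move=> a x y /=; rewrite mulr0 addr0.
move=> a f g; rewrite !unfold_in => /asboolP[fl fc] /asboolP[gl gc].
apply/asboolP; split.
  move=> b x y; rewrite /= -[LHS]/(a * f _ + g _) fl gl.
  rewrite -[X in _ = _ * X + _]/(a * f _ + g _) -[X in _ = _ + X]/(a * f _ + g _).
  by rewrite !mulrDr addrACA (mulrCA b).
by move=> x; apply: cvgD; [apply: cvgZl_tmp; exact: fc|exact: gc].
Qed.

HB.instance Definition _ :=
  GRing.isSubmodClosed.Build R (X -> R^o) dual_pred dual_submod_closed.

Record dual := Dual { dual_val :> X -> R^o; _ : dual_val \in dual_pred }.

HB.instance Definition _ := [isSub for dual_val].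
HB.instance Definition _ := [Choice of dual by <:].
HB.instance Definition _ := [SubChoice_isSubLmodule of dual by <:].

Lemma dual_scalar (f : dual) : scalar f.
Proof. by case: f => f /=; rewrite unfold_in => /asboolP[]. Qed.

Lemma dual_continuous (f : dual) : continuous f.
Proof. by case: f => f /=; rewrite unfold_in => /asboolP[]. Qed.

HB.instance Definition _ (f : dual) :=
  GRing.isLinear.Build R X R^o *%R (dual_val f) (@dual_scalar f).

Definition dual_norm (f : dual) : R :=
  sup [set `|f x| | x in [set x : X | `|x| <= 1]].

Lemma dual_bounded (f : dual) : exists2 M, 0 <= M & forall x, `|f x| <= M * `|x|.
Proof.
pose g : {linear X -> R^o} := HB.pack (dual_val f)
  (GRing.isLinear.Build R X R^o *:%R (dual_val f) (@dual_scalar f)).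
have : continuous g by exact: dual_continuous.
move=> /linear_bounded_continuous/linear_boundedP/pinfty_ex_gt0[M M0 fM].
by exists M => //; exact: ltW.
Qed.

Lemma dual_norm_has_sup (f : dual) :
  has_sup [set `|f x| | x in [set x : X | `|x| <= 1]].
Proof.
split; first by exists `|f 0|, 0 => //=; rewrite normr0.
have [M M0 fM] := dual_bounded f; exists M => _ [x /= x1 <-].
by rewrite (le_trans (fM x))// ler_piMr.
Qed.

Lemma dual_norm_ub (f : dual) x : `|f x| <= dual_norm f * `|x|.
Proof.
have [->|x0] := eqVneq x 0; first by rewrite linear0 !normr0 mulr0.
have nx : 0 < `|x| by rewrite normr_gt0.
rewrite -ler_pdivrMr//; apply: (sup_upper_bound (dual_norm_has_sup f)).
exists (`|x|^-1 *: x); first by rewrite /= normrZ normfV normr_id mulVf// gt_eqF.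
by rewrite linearZ/= normrM normfV normr_id mulrC.
Qed.

Lemma dual_norm_le (f : dual) M :
  0 <= M -> (forall x, `|f x| <= M * `|x|) -> dual_norm f <= M.
Proof.
move=> M0 fM; apply: ge_sup; first by have [] := dual_norm_has_sup f.
by move=> _ [x /= x1 <-]; rewrite (le_trans (fM x))// ler_piMr.
Qed.

Lemma dual_norm_ge0 (f : dual) : 0 <= dual_norm f.
Proof.
apply: le_trans (normr_ge0 (f 0)) _.
apply: (sup_upper_bound (dual_norm_has_sup f)).
by exists 0 => //=; rewrite normr0.
Qed.

Let dual_normD (f g : dual) : dual_norm (f + g) <= dual_norm f + dual_norm g.
Proof.
apply: dual_norm_le => [|x]; first by rewrite addr_ge0 ?dual_norm_ge0.
rewrite mulrDl (le_trans (ler_normD (f x) (g x)))//.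
by rewrite lerD// dual_norm_ub.
Qed.

Let dual_normZ_le (a : R) (f : dual) : dual_norm (a *: f) <= `|a| * dual_norm f.
Proof.
apply: dual_norm_le => [|x]; first by rewrite mulr_ge0 ?dual_norm_ge0.
by rewrite -[(a *: f) x]/(a * f x) normrM -mulrA ler_wpM2l// dual_norm_ub.
Qed.

Let dual_normZ (a : R) (f : dual) : dual_norm (a *: f) = `|a| * dual_norm f.
Proof.
apply/eqP; rewrite eq_le dual_normZ_le/=.
have [->|a0] := eqVneq a 0; first by rewrite normr0 mul0r dual_norm_ge0.
rewrite -ler_pdivlMl ?normr_gt0// -normfV.
by rewrite (le_trans _ (dual_normZ_le _ _))// scalerA mulVf// scale1r.
Qed.

Let dual_norm0_eq0 (f : dual) : dual_norm f = 0 -> f = 0.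
Proof.
move=> f0; apply/val_inj/funext => x /=.
by apply/eqP; rewrite -normr_le0 (le_trans (dual_norm_ub f x))// f0 mul0r.
Qed.

HB.instance Definition _ :=
  Lmodule_isNormed.Build R dual dual_normD dual_normZ dual_norm0_eq0.

Lemma dual_normE (f : dual) : `|f| = dual_norm f. Proof. by []. Qed.

End dual_space.
Arguments dual {R} X.

Definition pairing {R : realType} {X : normedModType R} (x : X) (xs : dual X) : R :=
  xs x.

Definition reflexive_space {R : realType} (X : normedModType R) : Prop :=
  forall phi : dual (dual X), exists x : X, forall xs : dual X,
    pairing xs phi = pairing x xs.

Section set_valued_operators.
Context {X Y : Type}.

Definition op_gra (A : X -> set Y) : set (X * Y) := [set p | A p.1 p.2].

Definition op_dom (A : X -> set Y) : set X := [set x | A x !=set0].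

Definition op_ran (A : X -> set Y) : set Y := \bigcup_x A x.

Definition op_inv (A : X -> set Y) : Y -> set X := fun y => [set x | A x y].

Definition op_image (A : X -> set Y) (C : set X) : set Y := \bigcup_(x in C) A x.

Definition op_surjective (A : X -> set Y) : Prop := op_ran A = setT.

Definition op_injective (A : X -> set Y) : Prop :=
  forall x y, A x `&` A y !=set0 -> x = y.

Definition op_of_map (D : set X) (W : D -> Y) : X -> set Y :=
  fun x => [set W d | d in [set d : D | \val d = x]].

End set_valued_operators.

Definition op_comp {X Y Z : Type} (B : Y -> set Z) (A : X -> set Y) : X -> set Z :=
  fun x => op_image B (A x).

Definition mink_add {V : zmodType} (C D : set V) : set V :=
  [set c + d | c in C & d in D].

Definition mink_scale {R : realType} {V : lmodType R} (g : R) (C : set V) : set V :=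
  [set g *: c | c in C].

Definition op_add {X : Type} {V : zmodType} (A B : X -> set V) : X -> set V :=
  fun x => mink_add (A x) (B x).

Definition op_scale {R : realType} {X : Type} {V : lmodType R} (g : R)
    (A : X -> set V) : X -> set V :=
  fun x => mink_scale g (A x).

Definition op_shift {X : Type} {V : zmodType} (A : X -> set V) (u : V) : X -> set V :=
  fun x => [set xs - u | xs in A x].

Definition warped_resolvent {X : Type} {V : zmodType} (K A : X -> set V) : X -> set X :=
  op_comp (op_inv (op_add K A)) K.

Section monotonicity.
Context {R : realType} {X : normedModType R}.
Implicit Types (A : X -> set (dual X)) (f : X -> \bar R).

Definition op_monotone A : Prop :=
  forall x xs y ys, A x xs -> A y ys -> 0 <= pairing (x - y) (xs - ys).

Definition strictly_monotone A : Prop :=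
  op_monotone A /\
  forall x xs y ys, A x xs -> A y ys -> x != y -> 0 < pairing (x - y) (xs - ys).

Definition maximally_monotone A : Prop :=
  forall x xs, A x xs <-> forall y ys, A y ys -> 0 <= pairing (x - y) (xs - ys).

(* Only the restriction of phi to [0, +oo[ is relevant; increasing is meant in
   the wide sense. *)
Definition modulus (phi : R -> \bar R) : Prop :=
  [/\ forall t, 0 <= t -> (0 <= phi t)%E,
      forall s t, 0 <= s -> s <= t -> (phi s <= phi t)%E &
      forall t, 0 <= t -> (phi t = 0%E <-> t = 0)].

Definition uniformly_monotone_with (phi : R -> \bar R) A : Prop :=
  modulus phi /\
  forall x xs y ys, A x xs -> A y ys ->
    (phi `|x - y|%R <= (pairing (x - y) (xs - ys))%:E)%E.

Definition uniformly_monotone A : Prop :=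
  exists phi, uniformly_monotone_with phi A.

Definition strongly_monotone (rho : R) A : Prop :=
  0 < rho /\ uniformly_monotone_with (fun t => (rho * t ^+ 2)%:E) A.

Definition haraux A (p : X * dual X) : \bar R :=
  ereal_sup [set (pairing (p.1 - q.1) (q.2 - p.2))%:E | q in op_gra A].

Definition dom_haraux A : set (X * dual X) := [set p | (haraux A p < +oo)%E].

Definition star3_monotone A : Prop :=
  op_monotone A /\ op_dom A `*` op_ran A `<=` dom_haraux A.

Definition jointly_strongly_monotone (a b : R) (D : set X) (W : D -> dual X) : Prop :=
  forall x y : D,
    a / 2 * `|\val x - \val y| ^+ 2 + b / 2 * `|W x - W y| ^+ 2 <=
    pairing (\val x - \val y) (W x - W y).

Definition proper_function f : Prop :=
  (forall x, (-oo < f x)%E) /\ exists x, (f x < +oo)%E.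

(* The library's convex_function only covers real-valued functions. *)
Definition convex_efunction f : Prop :=
  forall x y (t : R), 0 < t < 1 ->
    (f (t *: x + (1 - t) *: y)%R <= t%:E * f x + (1 - t)%:E * f y)%E.

Definition Gamma0 f : Prop :=
  [/\ proper_function f, lower_semicontinuous f & convex_efunction f].

Definition subdifferential f : X -> set (dual X) :=
  fun x => [set xs | forall y, ((pairing (y - x) xs)%:E + f x <= f y)%E].

Definition fenchel_conjugate f : dual X -> \bar R :=
  fun xs => ereal_sup [set ((pairing x xs)%:E - f x)%E | x in [set: X]].

Definition pair_norm (g : R) (p : X * dual X) : R :=
  Num.sqrt (`|p.1| ^+ 2 / g + g * `|p.2| ^+ 2).

Definition pair_dist (g : R) (C : set (X * dual X)) (p : X * dual X) : \bar R :=
  ereal_inf [set (pair_norm g (p - q))%:E | q in C].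

End monotonicity.

Definition locally_bounded_at {R : realType} {X Y : normedModType R}
    (A : X -> set Y) (x : X) : Prop :=
  exists2 U, nbhs x U & bounded_set (op_image A U).

(* The filter "y in S and |y| tends to +oo" (improper when S is bounded). *)
Definition norm_pinfty {R : realType} {X : normedModType R} (S : set X) :
    set_system X :=
  filter_from [set: R] (fun r => [set y | S y /\ r < `|y|]).

(* Main.v *)
Require Import Defs.
From HB Require Import structures.
From mathcomp Require Import all_boot all_order all_algebra.
From mathcomp Require Import all_classical all_reals all_analysis.
From mathcomp Require Import ring lra.
Import numFieldNormedType.Exports.
Import Order.TTheory GRing.Theory Num.Theory.

Set Implicit Arguments.
Unset Strict Implicit.
Unset Printing Implicit Defensive.

Local Open Scope classical_set_scope.
Local Open Scope ring_scope.

(** Both inequalities are elementary: if [W z + gamma a = W x + gamma us] with [a] in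
[A z], then [a - us = (W x - W z) / gamma], so that [(z, a)] is a competitor in the
supremum defining the Haraux function and in the infimum defining the distance, and
joint strong monotonicity compares the two. Injectivity, strict monotonicity, or
uniform monotonicity of one summand and monotonicity of the other all make [S = W +
gamma A] injective, hence [z] unique. All the difficulty lies in the existence of [z],
i.e., in showing that [W x + gamma us] is in the range of [S], when [S] is maximally
monotone.

The core is [solvable_of_weakly_bounded]: for a maximally monotone [T] on a reflexive
space, a point [(a, av)] of its graph and a target [ys], the target is in the range as
soon as the points [x] with [xs] in [T x], [|xs - ys| <= |av - ys|] and [<x - a, ys -
xs> >= 0] form a bounded set. Indeed, regularize the inclusion [ys \in T x] to [ys \in
T x + d J (x - a)], where [J] is the duality mapping. The regularized inclusion is
solvable for each [d > 0] ([rockafellar]), monotonicity puts its solutions in the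
above set, and boundedness makes [d J (x - a)] vanish with [d]. A weak limit of the
solutions then solves the original inclusion ([maximally_monotone_range_closed]).

The solvability of [0 \in T y + J y] is obtained without renorming the space. The
Fitzpatrick function of [T] lies above the pairing, hence above minus the convex
function [(|w|^2 + |ws|^2) / 2] on the product of the space and its dual; a
Hahn-Banach separation of the two produces an affine function which, by reflexivity,
is given by a point of the product, and maximality forces this point to be the
solution.

Boundedness of the domain, coercivity, and uniform monotonicity bound the solution set
directly. So does local boundedness of the inverse when [av] is close to [ys], and a
connectedness argument reduces to this case. The conditions on the ranges of the
summands, combined with 3* monotonicity, yield the Brezis-Haraux condition: for each
[vs] there is a point [p] with [sup <p - x, xs - vs> < +oo] over the graph. It bounds
the solutions pointwise on the dual, and the uniform boundedness principle concludes
([surjective_of_bounded_above]). *)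

(* Simplification would otherwise unfold the pairing into a bare application, out of
   reach of the bilinearity rules. *)
#[local] Arguments pairing : simpl never.

(** * Hahn-Banach theorem and separation of convex functions *)

Section hahn_banach.
Context {R : realType} {E : lmodType R}.
Implicit Types (p q : E -> R) (S : E -> set R).

(** Homogeneity is only asked as an inequality: applied to [t] and [t^-1] it
gives the equality, and with subadditivity it gives [p 0 = 0]. *)
Definition sublinear p : Prop :=
  (forall x y, p (x + y) <= p x + p y) /\
  (forall t x, 0 < t -> p (t *: x) <= t * p x).

Lemma sublinearD p : sublinear p -> forall x y, p (x + y) <= p x + p y.
Proof. by case. Qed.

Lemma sublinear0 p : sublinear p -> p 0 = 0.
Proof.
move=> [pD pZ]; have := pD 0 0; have := pZ 2^-1 0; rewrite scaler0 addr0.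
by move=> /(_ ltac:(by rewrite invr_gt0)); lra.
Qed.

Lemma sublinearZ p t x : sublinear p -> 0 <= t -> p (t *: x) = t * p x.
Proof.
move=> sp; rewrite le_eqVlt => /predU1P[<-|t0].
  by rewrite scale0r mul0r sublinear0.
apply/eqP; rewrite eq_le sp.2//= -ler_pdivlMl//.
have := sp.2 t^-1 (t *: x).
by rewrite scalerA mulVf ?gt_eqF// scale1r invr_gt0; apply.
Qed.

(** The three sublinear functions constructed below (the infimum of a chain, the
tilt of a function along a direction, the gauge of a pair of convex functions) are
all infima of this form. The condition at [0] is what keeps the infima
finite: a value at [v] plus a value at [- v] dominates a value at [0]. *)
Lemma inf_sublinear S :
  (forall v, S v !=set0) ->
  (forall v w s t, S v s -> S w t -> exists2 r, S (v + w) r & r <= s + t) ->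
  (forall v t s, 0 < t -> S v s -> S (t *: v) (t * s)) ->
  (forall s, S 0 s -> 0 <= s) ->
  sublinear (fun v => inf (S v)) /\ forall v s, S v s -> inf (S v) <= s.
Proof.
move=> S0 SD SZ Sge0.
have hi v : has_inf (S v).
  split; first exact: S0.
  have [t St] := S0 (- v); exists (- t) => s Ss.
  have [r] := SD _ _ _ _ Ss St; rewrite subrr => /Sge0; lra.
have il v s : S v s -> inf (S v) <= s by move=> Ss; apply: (ge_inf (hi v).2).
split=> //; split=> [v w|t v t0].
  rewrite -lerBlDr; apply: lb_le_inf; first exact: S0.
  move=> s Ss; rewrite lerBlDl -lerBlDr; apply: lb_le_inf; first exact: S0.
  move=> t St; have [r /il Sr rst] := SD _ _ _ _ Ss St.
  by rewrite lerBlDr (le_trans Sr)// addrC.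
rewrite mulrC -ler_pdivrMr//; apply: lb_le_inf; first exact: S0.
by move=> s Ss; rewrite ler_pdivrMr// mulrC; apply: il; apply: SZ.
Qed.

(** Tilting [p] along [y], i.e., passing to [v |-> inf_(t >= 0) (p (v + t y) - t p y)],
gives a sublinear function below [p] whose value at [- y] is at most [- p y]. A minimal
[p] equals its tilts, hence is odd, and an odd sublinear function is linear. *)
Lemma minimal_sublinear_scalar p : sublinear p ->
  (forall q, sublinear q -> (forall v, q v <= p v) -> forall v, p v <= q v) ->
  scalar p.
Proof.
move=> sp pmin.
have pN y : p (- y) = - p y.
  apply/eqP; rewrite eq_le; apply/andP; split; last first.
    have := sublinearD sp (- y) y; rewrite addNr (sublinear0 sp); lra.
  pose S v := [set p (v + t *: y) - t * p y | t in [set t | 0 <= t]].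
  have [||v t _ t0 [s /= s0 <-]|_ [t /= t0 <-]|sq Sq] := @inf_sublinear S.
  - by move=> v; exists (p (v + 0 *: y) - 0 * p y), 0 => /=.
  - move=> v w _ _ [s /= s0 <-] [t /= t0 <-].
    exists (p (v + w + (s + t) *: y) - (s + t) * p y).
      by exists (s + t) => //=; rewrite addr_ge0.
    have := sublinearD sp (v + s *: y) (w + t *: y).
    by rewrite addrACA -scalerDl; lra.
  - exists (t * s); first by rewrite /= mulr_ge0// ltW.
    by rewrite -scalerA -scalerDr (sublinearZ _ sp (ltW t0)); ring.
  - by rewrite add0r (sublinearZ _ sp t0) subrr.
  have /(pmin _ sq)/(_ (- y)) : forall v, inf (S v) <= p v.
    by move=> v; apply: Sq; exists 0 => //=; rewrite scale0r addr0 mul0r subr0.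
  move=> /le_trans; apply; apply: Sq; exists 1 => //=.
  by rewrite scale1r addNr (sublinear0 sp) mul1r sub0r.
have pD x y : p (x + y) = p x + p y.
  apply/eqP; rewrite eq_le (sublinearD sp)//=.
  by have := sublinearD sp (x + y) (- y); rewrite addrK pN; lra.
move=> t x y; rewrite pD; congr (_ + _).
have [t0|t0] := leP 0 t; first exact: sublinearZ.
rewrite -[t]opprK scaleNr pN (sublinearZ _ sp) ?mulNr//; lra.
Qed.

(** Zorn's lemma on the sublinear functions below [p], with the reverse order. A lower
bound of a chain is its pointwise infimum. *)
Theorem hahn_banach p : sublinear p ->
  exists2 L : E -> R, scalar L & forall v, L v <= p v.
Proof.
move=> sp; pose P (q : E -> R) := sublinear q /\ forall v, q v <= p v; pose T := {q | P q}.
pose le (q r : T) := `[< forall v, sval r v <= sval q v >].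
have [|||[q [sq qp]] qmax] := @ZL_preorder T (exist P p (conj sp (fun v => lexx _))) le.
- by move=> q; apply/asboolP.
- move=> q r s /asboolP qr /asboolP rs; apply/asboolP => v.
  exact: le_trans (rs v) (qr v).
- move=> A Atot; have [[q0 Aq0]|A0] := pselect (A !=set0); last first.
    exists (exist P p (conj sp (fun v => lexx _))) => q Aq.
    by exfalso; apply: A0; exists q.
  pose S v := [set sval q v | q in A].
  have [||v t _ t0 [q Aq <-]|_ [q _ <-]|si Si] := @inf_sublinear S.
  + by move=> v; exists (sval q0 v), q0.
  + move=> v w _ _ [q Aq <-] [r Ar <-].
    have [/asboolP qr|/asboolP rq] := Atot _ _ Aq Ar.
    * exists (sval r (v + w)); first by exists r.
      by rewrite (le_trans ((svalP r).1.1 v w))// lerD2r.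
    * exists (sval q (v + w)); first by exists q.
      by rewrite (le_trans ((svalP q).1.1 v w))// lerD2l.
  + by exists q => //; rewrite (sublinearZ _ (svalP q).1 (ltW t0)).
  + by rewrite (sublinear0 (svalP q).1).
  have ip v : inf (S v) <= p v.
    by apply: le_trans ((svalP q0).2 v); apply: Si; exists q0.
  exists (exist P _ (conj si ip)) => q Aq.
  by apply/asboolP => v /=; apply: Si; exists q.
exists q => //; apply: (minimal_sublinear_scalar sq) => r sr rq.
have rp v : r v <= p v by exact: le_trans (rq v) (qp v).
by have /asboolP := qmax (exist P r (conj sr rp)) (asboolT rq).
Qed.

(** The set [K] plays the epigraph of a convex function whose opposite is below [g].
The function [v |-> inf t (g w + r)], over the representations [v = t (w - u)]
with [t > 0] and [(u, r)] in [K], is sublinear, and any linear function below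
it separates. *)
Lemma sandwich (K : set (E * R)) (g : E -> R) : K !=set0 ->
  (forall u v s t, 0 < s -> 0 < t -> s + t = 1 -> K u -> K v ->
    K (s *: u.1 + t *: v.1, s * u.2 + t * v.2)) ->
  (forall u v s t, 0 < s -> 0 < t -> s + t = 1 ->
    g (s *: u + t *: v) <= s * g u + t * g v) ->
  (forall u, K u -> 0 <= g u.1 + u.2) ->
  exists2 L : E -> R, scalar L & forall w u, K u -> L (w - u.1) <= g w + u.2.
Proof.
move=> [u0 Ku0] Kconv gconv Kg.
pose S v := [set r | exists t w u,
  [/\ 0 < t, K u, v = t *: (w - u.1) & r = t * (g w + u.2)]].
have [||v t _ t0 [s [w [u [s0 Ku -> ->]]]]|_ [t [w [u [t0 Ku + ->]]]]|si Si] :=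
    @inf_sublinear S.
- move=> v; exists (1 * (g (v + u0.1) + u0.2)), 1, (v + u0.1), u0.
  by split; rewrite // scale1r addrK.
- move=> _ _ _ _ [s [w [u [s0 Ku -> ->]]]] [t [w' [u' [t0 Ku' -> ->]]]].
  have st0 : 0 < s + t by rewrite addr_gt0.
  have stN : s + t != 0 by rewrite gt_eqF.
  have st1 : s / (s + t) + t / (s + t) = 1 by rewrite -mulrDl divff.
  pose c := s / (s + t); pose d := t / (s + t).
  have c0 : 0 < c by rewrite divr_gt0.
  have d0 : 0 < d by rewrite divr_gt0.
  have cE : (s + t) * c = s by rewrite /c mulrCA divff ?mulr1.
  have dE : (s + t) * d = t by rewrite /d mulrCA divff ?mulr1.
  exists ((s + t) * (g (c *: w + d *: w') + (c * u.2 + d * u'.2))).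
    exists (s + t), (c *: w + d *: w'),
      (c *: u.1 + d *: u'.1, c * u.2 + d * u'.2); split => //.
      exact: Kconv.
    rewrite /= opprD addrACA -!scalerBr [RHS]scalerDr !scalerA.
    by rewrite cE dE.
  have := gconv w w' c d c0 d0 st1; rewrite -(ler_pM2l st0) => h.
  rewrite -[X in _ <= X * _ + _]cE -[X in _ <= _ + X * _]dE; lra.
- by exists (t * s), w, u; split; rewrite ?mulr_gt0 ?scalerA ?mulrA.
- move=> /eqP; rewrite eq_sym scaler_eq0 (gt_eqF t0)/= subr_eq0 => /eqP ->.
  by rewrite mulr_ge0 ?Kg// ltW.
have [L sL Lp] := hahn_banach si.
exists L => // w u Ku; apply: le_trans (Lp _) _; apply: Si.
by exists 1, w, u; split; rewrite ?scale1r ?mul1r.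
Qed.

End hahn_banach.

(** * Duality pairing and the theorem of Rockafellar *)

Section duality.
Context {R : realType} {X : normedModType R}.
Implicit Types (x y : X) (f g : dual X).

Lemma pairingDl x y f : pairing (x + y) f = pairing x f + pairing y f.
Proof. exact: linearD. Qed.

Lemma pairingNl x f : pairing (- x) f = - pairing x f.
Proof. exact: linearN. Qed.

Lemma pairingZl a x f : pairing (a *: x) f = a * pairing x f.
Proof. exact: linearZ. Qed.

Lemma pairing0l f : pairing 0 f = 0.
Proof. exact: linear0. Qed.

Lemma pairingDr x f g : pairing x (f + g) = pairing x f + pairing x g.
Proof. by []. Qed.

Lemma pairingNr x f : pairing x (- f) = - pairing x f.
Proof. by []. Qed.

Lemma pairingZr a x f : pairing x (a *: f) = a * pairing x f.
Proof. by []. Qed.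

Lemma pairing0r x : pairing x (0 : dual X) = 0.
Proof. by []. Qed.

Definition pairingE := (pairingDl, pairingNl, pairingZl, pairing0l,
  pairingDr, pairingNr, pairingZr, pairing0r).

Lemma le_pairing x f : `|pairing x f| <= `|f| * `|x|.
Proof. exact: dual_norm_ub. Qed.

Lemma pairing_le x f : pairing x f <= `|f| * `|x|.
Proof. exact: le_trans (ler_norm _) (le_pairing _ _). Qed.

(** A bound from above on the unit ball suffices since the ball is symmetric. *)
Lemma scalar_dual (L : X -> R) (C : R) : scalar L ->
  (forall x, `|x| <= 1 -> L x <= C) -> exists f, forall x, pairing x f = L x.
Proof.
move=> sL LC.
pose l : {linear X -> R^o} := HB.pack L (GRing.isLinear.Build R X R^o *:%R L sL).
have L0 : L 0 = 0 := linear0 l.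
have LN x : L (- x) = - L x := linearN l x.
have LZ a x : L (a *: x) = a * L x.
  by rewrite -[a *: x]addr0 sL L0 addr0.
have lC x : `|L x| <= C * `|x|.
  have [->|x0] := eqVneq x 0; first by rewrite L0 !normr0 mulr0.
  have nx : 0 < `|x| by rewrite normr_gt0.
  rewrite -ler_pdivrMr//.
  have nx1 : `| `|x|^-1 *: x| <= 1 by rewrite normrZ normfV normr_id mulVf// gt_eqF.
  have := LC _ nx1; have := LC (- (`|x|^-1 *: x)); rewrite normrN => /(_ nx1).
  rewrite LN LZ => h1 h2.
  by case: ler0P => _; rewrite mulrC// mulrN.
have cL : continuous (L : X -> R^o).
  suff: continuous l by [].
  apply/linear_bounded_continuous/linear_boundedP.
  near=> M; move=> x; apply: le_trans (lC x) _; exact: ler_wpM2r.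
have dL : (L : X -> R^o) \in dual_pred by rewrite unfold_in; apply/asboolP.
by exists (Dual dL).
Unshelve. all: end_near. Qed.

(** Half of the fact that the conjugate of half the squared norm is half the squared
dual norm: optimizing over each line bounds [|f x| / |x|] by [sqrt (2 C)]. *)
Lemma half_norm_conjugate f C :
  (forall x, pairing x f - 2^-1 * `|x| ^+ 2 <= C) -> 2^-1 * `|f| ^+ 2 <= C.
Proof.
move=> fC.
have C0 : 0 <= C by have := fC 0; rewrite pairing0l normr0 expr0n/= mulr0 subr0.
have fS : `|f| <= Num.sqrt (2 * C).
  rewrite dual_normE; apply: dual_norm_le => [|x]; first exact: sqrtr_ge0.
  have [->|x0] := eqVneq x 0; first by rewrite linear0 !normr0 mulr0.
  have nx : 0 < `|x| by rewrite normr_gt0.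
  set s := f x; set n := `|x|.
  have sC : s ^+ 2 / n ^+ 2 <= 2 * C.
    (* On the line spanned by [x] the hypothesis is sharpest at this point. *)
    have := fC ((s / n ^+ 2) *: x).
    rewrite pairingZl normrZ exprMn real_normK ?num_real// -/n.
    rewrite /pairing -/s.
    have -> : s / n ^+ 2 * s - 2^-1 * ((s / n ^+ 2) ^+ 2 * n ^+ 2) = s ^+ 2 / n ^+ 2 / 2.
      by field; rewrite gt_eqF.
    lra.
  have -> : `|s| = Num.sqrt (s ^+ 2 / n ^+ 2) * n.
    by rewrite -expr_div_n sqrtr_sqr normrM normfV (ger0_norm (ltW nx)) divfK ?gt_eqF.
  by rewrite ler_wpM2r// ?ler_wsqrtr// ltW.
have : `|f| ^+ 2 <= Num.sqrt (2 * C) ^+ 2 by rewrite ler_pXn2r ?nnegrE ?sqrtr_ge0.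
rewrite sqr_sqrtr; lra.
Qed.

End duality.

Lemma sqr_norm_convex (R : realType) (V : normedModType R) (u v : V) (s t : R) :
  0 < s -> 0 < t -> s + t = 1 ->
  `|s *: u + t *: v| ^+ 2 <= s * `|u| ^+ 2 + t * `|v| ^+ 2.
Proof.
move=> s0 t0 st.
have h : `|s *: u + t *: v| <= s * `|u| + t * `|v|.
  by rewrite (le_trans (ler_normD _ _))// !normrZ !gtr0_norm.
have : `|s *: u + t *: v| ^+ 2 <= (s * `|u| + t * `|v|) ^+ 2.
  by rewrite ler_pXn2r ?nnegrE// addr_ge0// mulr_ge0// ltW.
move=> /le_trans; apply.
have -> : t = 1 - s by lra.
have := mulr_ge0 (mulr_ge0 (ltW s0) (ltW t0)) (sqr_ge0 (`|u| - `|v|)).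
have -> : t = 1 - s by lra.
nra.
Qed.

Section rockafellar.
Context {R : realType} {X : normedModType R}.
Implicit Types (T : X -> set (dual X)).

Lemma maximally_monotone_monotone T : maximally_monotone T -> op_monotone T.
Proof. by move=> Tmax x xs y ys /Tmax + Tys; apply. Qed.

(** The epigraph of the Fitzpatrick function of [T]. Working with the epigraph
avoids extended real values. *)
Definition fitzpatrick_epi T : set ((X * dual X) * R) :=
  [set q | forall b bs, T b bs ->
    pairing q.1.1 bs + pairing b q.1.2 - pairing b bs <= q.2].

(** If [r < <u, us>], then [(u, us)] is monotonically related to the graph, hence
belongs to it by maximality, and testing the epigraph at this very point gives
[<u, us> <= r]. *)
Lemma fitzpatrick_epi_ge T q : maximally_monotone T -> fitzpatrick_epi T q ->
  pairing q.1.1 q.1.2 <= q.2.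
Proof.
case: q => -[u us] r /= Tmax Tq; rewrite leNgt; apply/negP => rlt.
have Tu : T u us.
  apply/Tmax => b bs /Tq/=; rewrite !pairingE; lra.
have /= := Tq _ _ Tu; lra.
Qed.

Lemma fitzpatrick_epi_gra T a av : op_monotone T -> T a av ->
  fitzpatrick_epi T ((a, av), pairing a av).
Proof.
by move=> Tmon Ta b bs Tb /=; have := Tmon _ _ _ _ Ta Tb; rewrite !pairingE; lra.
Qed.

(** In other words, [- ys] belongs to the image of [y] by the duality mapping, so that
[0] is in the range of [T + J]. The norm of [y] appears through its action on the
dual, i.e., as the norm of its image in the bidual. *)
Theorem rockafellar T : reflexive_space X -> maximally_monotone T ->
  exists y ys, [/\ T y ys, pairing y ys = - `|ys| ^+ 2 &
    forall vs, `|pairing y vs| <= `|ys| * `|vs|].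
Proof.
move=> Xrefl Tmax; have Tmon := maximally_monotone_monotone Tmax.
have [a [av Ta]] : exists a av, T a av.
  have [//|noT] := pselect (exists a av, T a av).
  by exists 0, 0; apply/Tmax => b bs Tb; exfalso; apply: noT; exists b, bs.
pose g (w : X * dual X) : R := 2^-1 * `|w.1| ^+ 2 + 2^-1 * `|w.2| ^+ 2.
have [||||L sL Lg] := @sandwich R (X * dual X)%type (fitzpatrick_epi T) g.
- by exists ((a, av), pairing a av); exact: fitzpatrick_epi_gra.
- move=> [[u us] r] [[v vs] r'] s t s0 t0 st /= Ku Kv b bs Tb /=.
  have /(ler_wpM2l (ltW s0)) /= := Ku _ _ Tb.
  have /(ler_wpM2l (ltW t0)) /= := Kv _ _ Tb.
  rewrite !pairingE; have -> : t = 1 - s by lra.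
  lra.
- move=> [u us] [v vs] s t s0 t0 st; rewrite /g /=.
  have := sqr_norm_convex u v s0 t0 st.
  have := sqr_norm_convex us vs s0 t0 st.
  lra.
- move=> [[u us] r] /(fitzpatrick_epi_ge Tmax)/=; rewrite /g/=.
  have := le_pairing u us; rewrite ler_norml => /andP[h _].
  have := sqr_ge0 (`|u| - `|us|); nra.
pose l : {linear (X * dual X)%type -> R^o} :=
  HB.pack L (GRing.isLinear.Build R (X * dual X)%type R^o *:%R L sL).
have LD w w' : L (w + w') = L w + L w' := linearD l w w'.
have LN w : L (- w) = - L w := linearN l w.
have Lsplit x xs : L (x, xs) = L (x, 0) + L (0, xs).
  by rewrite -LD; congr (L (_, _)); rewrite ?addr0 ?add0r.
have Ka := fitzpatrick_epi_gra Tmon Ta.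
have Lbound x xs : `|x| <= 1 -> `|xs| <= 1 ->
    - L (x, xs) <= 1 + L (a, av) + pairing a av.
  move=> x1 xs1; have := Lg (- (x, xs)) _ Ka; rewrite LD !LN /g /= !normrN.
  have : `|x| ^+ 2 <= 1 by rewrite expr_le1.
  have : `|xs| ^+ 2 <= 1 by rewrite expr_le1.
  lra.
have [ys ysE] : exists ys : dual X, forall x, pairing x ys = - L (x, 0).
  apply: (scalar_dual (C := 1 + L (a, av) + pairing a av)) => [t x x'|x x1].
    have -> : (t *: x + x', 0) = t *: (x, 0) + (x', 0) :> X * dual X.
      by congr (_, _); rewrite /= ?scaler0 ?addr0.
    by rewrite sL opprD mulrN.
  by apply: Lbound => //; rewrite normr0.
have [phi phiE] : exists phi : dual (dual X), forall xs, pairing xs phi = - L (0, xs).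
  apply: (scalar_dual (C := 1 + L (a, av) + pairing a av)) => [t x x'|x x1].
    have -> : (0, t *: x + x') = t *: (0, x) + (0, x') :> X * dual X.
      by congr (_, _); rewrite /= ?scaler0 ?addr0.
    by rewrite sL opprD mulrN.
  by apply: Lbound => //; rewrite normr0.
have [y yE] := Xrefl phi.
exists y, ys.
(* Taking the supremum over [w] and [ws] in the separation turns [g] into its
   conjugate. *)
have key b bs : T b bs -> 2^-1 * `|ys| ^+ 2 + 2^-1 * `|phi| ^+ 2 <=
    pairing b bs - pairing b ys - pairing y bs.
  move=> Tb; rewrite addrC -lerBrDr -[`|phi|]normrN.
  apply: half_norm_conjugate => ws.
  set C := pairing b bs - _ - _; set D := pairing ws _ - _.
  suff: 2^-1 * `|ys| ^+ 2 <= C - D by lra.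
  rewrite -[`|ys|]normrN; apply: half_norm_conjugate => w; rewrite /C /D.
  have : L ((w, ws) - (b, bs)) <= g (w, ws) + pairing b bs.
    exact: Lg (fitzpatrick_epi_gra Tmon Tb).
  rewrite LD LN (Lsplit w) (Lsplit b) /g /=.
  rewrite !pairingNr -!yE !phiE !ysE; lra.
have phi_ys : 0 <= 2^-1 * `|ys| ^+ 2 + 2^-1 * `|phi| ^+ 2 + pairing y ys.
  have := le_pairing ys phi; rewrite yE ler_norml => /andP[h _].
  have := sqr_ge0 (`|phi| - `|ys|); nra.
(* The separation at graph points now says that [(y, ys)] is monotonically related
   to the graph. *)
have Ty : T y ys.
  by apply/Tmax => b bs /key; rewrite !pairingE; lra.
have := key _ _ Ty => keyy.
have : `|phi| = `|ys|.
  apply/eqP; rewrite -subr_eq0 -sqrf_eq0; apply/eqP.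
  have := le_pairing ys phi; rewrite yE ler_norml => /andP[h _].
  have := sqr_ge0 (`|phi| - `|ys|); nra.
move=> phiys; split => //.
  by rewrite phiys in keyy phi_ys; lra.
by move=> vs; rewrite -yE -phiys; exact: le_pairing.
Qed.

End rockafellar.

(** * Ranges of maximally monotone operators *)

Section range_closure.
Context {R : realType} {X : normedModType R}.
Implicit Types (T : X -> set (dual X)).

(** A bound on the image of [x] in the bidual: it is what weak limits and the
uniform boundedness principle handle, and it follows from [|x| <= M] at once. *)
Definition weakly_bounded_by (M : R) (x : X) : Prop :=
  forall xs, `|pairing x xs| <= M * `|xs|.

(** The image of an ultrafilter clusters in the segment by compactness, and an
ultrafilter converges to each of its cluster points. *)
Lemma ultra_bounded_cvg (I : Type) (F : set_system I) (u : I -> R) (M : R) :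
  UltraFilter F -> (forall i, `|u i| <= M) -> cvg (u @ F).
Proof.
move=> UF uM.
have PF : ProperFilter F by exact: ultra_proper.
have [|l [_ ul]] := @segment_compact R (- M) M (u @ F).
  by apply: nearW => i /=; rewrite in_itv/= -ler_norml.
apply/cvg_ex; exists l => B lB.
have [//|FB] := in_ultra_setVsetC (u @^-1` B) UF.
by have [x [/= nBx Bx]] := ul (~` B) B FB lB; exfalso; exact: nBx.
Qed.

(** Weak compactness of balls: along an ultrafilter, every bounded family has a limit
against each functional, these limits define an element of the bidual, and reflexivity
represents it. *)
Lemma weak_ultra_limit (I : Type) (F : set_system I) (u : I -> X) (M : R) :
  reflexive_space X -> UltraFilter F -> (forall i, weakly_bounded_by M (u i)) ->
  exists x, forall xs, pairing (u i) xs @[i --> F] --> pairing x xs.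
Proof.
move=> Xrefl UF uM.
have uc xs : cvg (pairing (u i) xs @[i --> F]).
  exact: (ultra_bounded_cvg UF (fun i => uM i xs)).
pose L xs : R := lim (pairing (u i) xs @[i --> F]).
have PF : ProperFilter F by exact: ultra_proper.
have [||phi phiE] := @scalar_dual R (dual X) L `|M|.
- move=> t xs ys; rewrite /L; apply: cvg_lim => //.
  under eq_fun do rewrite pairingDr pairingZr.
  apply: cvgD; last exact: uc.
  by apply: cvgMr; exact: uc.
- move=> xs xs1; apply: limr_le; first exact: uc.
  apply: nearW => i; apply: le_trans (ler_norm _) _; apply: le_trans (uM i xs) _.
  by apply: (@le_trans _ _ (`|M| * `|xs|)); rewrite ?ler_wpM2r ?ler_norm ?ler_piMr.
have [x xE] := Xrefl phi.
by exists x => xs; rewrite -xE phiE; exact: uc.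
Qed.

(** With [xs_n] converging in norm and [x_n] weakly along an ultrafilter, the inequalities
[<x_n - b, xs_n - bs> >= 0] pass to the limit, and maximality applies. *)
Lemma maximally_monotone_range_closed T (M : R) (ys : dual X) :
  reflexive_space X -> maximally_monotone T ->
  (forall e, 0 < e -> exists x xs, [/\ T x xs, weakly_bounded_by M x & `|xs - ys| <= e]) ->
  op_ran T ys.
Proof.
move=> Xrefl Tmax Tys.
have /choice[u uP] : forall n, exists p : X * dual X,
    [/\ T p.1 p.2, weakly_bounded_by M p.1 & `|p.2 - ys| <= n.+1%:R^-1].
  move=> n; have [|x [xs xP]] := Tys n.+1%:R^-1; first by rewrite invr_gt0.
  by exists (x, xs).
have [F [UF ooF]] := ultraFilterLemma eventually_filter.
have PF : ProperFilter F by exact: ultra_proper.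
have [|x ux] := @weak_ultra_limit nat F (fun n => (u n).1) M Xrefl UF.
  by move=> n; have [] := uP n.
exists x => //; apply/Tmax => b bs Tb.
pose lb n := pairing (u n).1 (ys - bs) - pairing b (ys - bs) + (`|M| + `|b|) * harmonic n.
have lb_cvg : lb n @[n --> F] -->
    pairing x (ys - bs) - pairing b (ys - bs) + (`|M| + `|b|) * 0.
  apply: cvgD; first by apply: cvgB; [exact: ux|exact: cvg_cst].
  by apply: cvgMr => B /cvg_harmonic; exact: ooF.
have : 0 <= pairing x (ys - bs) - pairing b (ys - bs) + (`|M| + `|b|) * 0.
  apply: (cvgr_to_ge lb_cvg).
  apply: nearW => n; have [Tu uM] := uP n; rewrite /lb /harmonic /=.
  move: (n.+1%:R^-1) => h un.
  have := maximally_monotone_monotone Tmax Tu Tb.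
  have := uM ((u n).2 - ys); rewrite ler_norml => /andP[_].
  have := le_pairing b ((u n).2 - ys); rewrite ler_norml => /andP[+ _].
  have := ler_wpM2l (normr_ge0 M) un; have := ler_wpM2l (normr_ge0 b) un.
  have := ler_wpM2r (normr_ge0 ((u n).2 - ys)) (ler_norm M).
  rewrite !pairingE; lra.
by rewrite mulr0 addr0 pairingDl pairingNl.
Qed.

(** Rockafellar's theorem is applied to the translated and rescaled operator
[w |-> (T (w + a) - ys) / d]: its solutions [(w, ws)] satisfy
[ys - xs = - d ws] with [<w, ws> = - |ws|^2], so the residual
[|xs - ys| = d |ws|] is at most [d] times a bound on [w]. Centering at [a] is what
yields the estimate [|xs - ys| <= |av - ys|], by monotonicity against [(a, av)]. *)
Theorem solvable_of_weakly_bounded T (a : X) (av ys : dual X) (M : R) :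
  reflexive_space X -> maximally_monotone T -> T a av ->
  (forall x xs, T x xs -> `|xs - ys| <= `|av - ys| -> 0 <= pairing (x - a) (ys - xs) ->
    weakly_bounded_by M x) ->
  op_ran T ys.
Proof.
move=> Xrefl Tmax Ta TM.
have M0 : 0 <= `|M| + `|a| by rewrite addr_ge0.
apply: (@maximally_monotone_range_closed _ M) => // e e0.
have [d d0 dM] : exists2 d, 0 < d & d * (`|M| + `|a|) <= e.
  exists (e / (`|M| + `|a| + 1)).
    by rewrite divr_gt0// ltr_wpDl.
  by rewrite mulrAC ler_pdivrMr ?ltr_wpDl// ler_wpM2l ?(ltW e0)// lerDl.
pose T' w := [set ws | T (w + a) (d *: ws + ys)].
have T'max : maximally_monotone T'.
  move=> w ws; split=> [/= Tw v vs /= Tv|Tw].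
    have := maximally_monotone_monotone Tmax Tw Tv.
    by rewrite [v + a]addrC addrKA [d *: vs + ys]addrC addrKA -scalerBr pairingZr pmulr_rge0.
  apply/Tmax => b bs Tb.
  have := Tw (b - a) (d^-1 *: (bs - ys)).
  rewrite /T' /= subrK scalerA divff ?gt_eqF// scale1r subrK => /(_ Tb).
  rewrite -(pmulr_rge0 _ d0) -pairingZr scalerBr scalerA divff ?gt_eqF// scale1r.
  by rewrite !pairingE; lra.
have [w [ws [Tw wws wM]]] := rockafellar Xrefl T'max.
exists (w + a), (d *: ws + ys).
have wsE : `|d *: ws + ys - ys| = d * `|ws| by rewrite addrK normrZ gtr0_norm.
have wsy : `|d *: ws + ys - ys| <= `|av - ys|.
  rewrite wsE.
  have [->|ws0] := eqVneq ws 0; first by rewrite normr0 mulr0.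
  have nws : 0 < `|ws| by rewrite normr_gt0.
  have h1 : d * `|ws| ^+ 2 <= pairing w (ys - av).
    have := maximally_monotone_monotone Tmax Tw Ta.
    by rewrite addrK -addrA (pairingDr w (d *: ws)) pairingZr wws; lra.
  have h2 : pairing w (ys - av) <= `|ws| * `|av - ys|.
    by rewrite [`|av - ys|]distrC (le_trans (ler_norm _)).
  by rewrite -(ler_pM2l nws) mulrCA -expr2 (le_trans h1).
have wb : weakly_bounded_by M (w + a).
  apply: TM wsy _ => //.
  rewrite addrK opprD addrCA subrr addr0 pairingNr pairingZr wws mulrN opprK.
  by rewrite mulr_ge0 ?sqr_ge0// ltW.
split=> //; rewrite wsE; apply: le_trans dM; rewrite ler_wpM2l ?(ltW d0)//.
have [->|ws0] := eqVneq ws 0; first by rewrite normr0.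
have nws : 0 < `|ws| by rewrite normr_gt0.
have aws : pairing a ws <= `|a| * `|ws| by rewrite mulrC pairing_le.
have waws : - pairing (w + a) ws <= `|M| * `|ws|.
  by rewrite (le_trans (ler_norm _))// normrN (le_trans (wb ws))// ler_wpM2r// ler_norm.
rewrite -(ler_pM2r nws) -expr2 mulrDl -[X in X <= _]opprK -wws.
have -> : - pairing w ws = - pairing (w + a) ws + pairing a ws.
  by rewrite pairingDl opprD subrK.
exact: lerD.
Qed.

End range_closure.

(** * Completeness of the dual and uniform boundedness *)

Section dual_complete.
Context {R : realType} {X : normedModType R}.

(** The pointwise limit is linear, bounded near a single element of the filter, and
the Cauchy estimate passes to the limit in each point of the space. *)
Lemma dual_cauchy_cvg (F : set_system (dual X)) : ProperFilter F -> cauchy F -> cvg F.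
Proof.
move=> PF Fc; have /cauchy_ballP Fb := Fc.
have Fx x : cvg (pairing x f @[f --> F]).
  apply: cauchy_cvg; apply/cauchy_ballP => e e0.
  have d0 : 0 < e / (`|x| + 1) by rewrite divr_gt0 ?ltr_wpDl.
  have [P [P1 P2] PE] := Fb _ d0.
  exists ((pairing x) @` P.1, (pairing x) @` P.2).
    by split; [apply: filterS P1|apply: filterS P2] => f Pf; exists f.
  move=> [_ _] /= [[f Pf <-] [g Pg <-]].
  have := PE (f, g) (conj Pf Pg); rewrite -!ball_normE /ball_ /= => fg.
  rewrite -pairingNr -pairingDr (le_lt_trans (le_pairing _ _))//.
  rewrite (@le_lt_trans _ _ (e / (`|x| + 1) * `|x|))//.
    by rewrite ler_wpM2r// ltW.
  by rewrite mulrAC ltr_pdivrMr ?ltr_wpDl// ltr_pM2l// ltrDl.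
pose L x : R := lim (pairing x f @[f --> F]).
have /cauchyP/(_ _ ltr01)[f0 f0F] := Fc.
have [||l lE] := @scalar_dual R X L (`|f0| + 1).
- move=> t x y; rewrite /L; apply: cvg_lim => //.
  under eq_fun do rewrite pairingDl pairingZl.
  apply: cvgD; last exact: Fx.
  by apply: cvgMr; exact: Fx.
- move=> x x1; apply: limr_le; first exact: Fx.
  apply: filterS f0F => f; rewrite -ball_normE /ball_ /= => ff.
  rewrite (le_trans (pairing_le _ _))// (@le_trans _ _ `|f|) ?ler_piMr//.
  have := ler_normB f0 (f0 - f); rewrite opprB addrCA subrr addr0; lra.
apply/cvg_ex; exists l; apply/cvgrPdist_le => e e0.
have [P [P1 P2] PE] := Fb _ e0.
apply: filterS P1 => f Pf.
rewrite dual_normE; apply: dual_norm_le; first exact: ltW.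
move=> x; rewrite -/(pairing x (l - f)) pairingDr pairingNr lE.
have cv : `|pairing x g - pairing x f| @[g --> F] --> `|L x - pairing x f|.
  by apply: cvg_norm; apply: cvgB; [exact: Fx|exact: cvg_cst].
apply: (cvgr_to_le cv).
apply: filterS P2 => g Pg.
have := PE (f, g) (conj Pf Pg); rewrite -!ball_normE /ball_ /= => fg.
rewrite -pairingNr -pairingDr (le_trans (le_pairing _ _))// ler_wpM2r//.
by rewrite distrC ltW.
Qed.

HB.instance Definition _ := isPointed.Build (dual X) 0.
HB.instance Definition _ := Uniform_isComplete.Build (dual X) dual_cauchy_cvg.

End dual_complete.

(** Banach-Steinhaus in the dual, for the evaluations at the points of [B]; bounds
from above suffice since they also hold at [- xs]. *)
Lemma weakly_bounded_of_bounded_above (R : realType) (X : normedModType R) (B : set X) :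
  (forall xs, exists M, forall x, B x -> pairing x xs <= M) ->
  exists M, forall x, B x -> weakly_bounded_by M x.
Proof.
move=> BM; pose F : set (dual X -> R^o) := [set pairing x | x in B].
have /(_ 1)[M FM] : uniform_bounded F.
  apply: (@Banach_Steinhauss R (dual X) R^o F).
  - move=> _ [x _ <-]; split.
      move=> r; exists (r * `|x|) => xs xsr.
      by rewrite (le_trans (le_pairing _ _))// ler_wpM2r.
    by move=> t xs ys; rewrite pairingDr pairingZr.
  - move=> xs; have [M1 xM1] := BM xs; have [M2 xM2] := BM (- xs).
    exists (Num.max M1 M2) => _ [x Bx <-].
    rewrite real_ler_norml ?num_real// le_max xM1// andbT lerNl le_max.
    by have := xM2 _ Bx; rewrite pairingNr => ->; rewrite orbT.
exists M => x Bx xs.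
have [->|xs0] := eqVneq xs 0; first by rewrite pairing0r !normr0 mulr0.
have nxs : 0 < `|xs| by rewrite normr_gt0.
rewrite -ler_pdivrMr//.
have := FM (pairing x) (ex_intro2 _ _ x Bx erefl) (`|xs|^-1 *: xs).
rewrite normrZ normfV normr_id mulVf ?gt_eqF// => /(_ (lexx _)).
by rewrite pairingZr normrM normfV normr_id mulrC.
Qed.

(** * Surjectivity of maximally monotone operators *)

Section surjectivity.
Context {R : realType} {X : normedModType R} (X_reflexive : reflexive_space X).
Context (T : X -> set (dual X)) (T_max : maximally_monotone T).

Lemma solvable_of_bounded (a : X) (av ys : dual X) (M : R) : T a av ->
  (forall x xs, T x xs -> `|xs - ys| <= `|av - ys| -> 0 <= pairing (x - a) (ys - xs) ->
    `|x| <= M) ->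
  op_ran T ys.
Proof.
move=> Ta TM; apply: (solvable_of_weakly_bounded (M := M) X_reflexive T_max Ta).
move=> x xs Tx xsy xa vs; rewrite (le_trans (le_pairing _ _))// mulrC ler_wpM2r//.
exact: TM Tx xsy xa.
Qed.

(** Near each [y0] the operator [T^-1] is bounded, so that once one point close
to [y0] is attained all of them are: the range is both open and closed. Connectedness
is used along the segment from an attained value to the target. *)
Lemma surjective_of_inv_locally_bounded : op_ran T !=set0 ->
  (forall ys, locally_bounded_at (op_inv T) ys) -> op_surjective T.
Proof.
move=> [av ran_as] Tlb.
have near_ran y0 : exists2 r, 0 < r & forall p q, `|p - y0| < r -> `|q - y0| < r ->
    op_ran T p -> op_ran T q.
  have [U /nbhs_ballP[e /= e0 eU]] := Tlb y0.
  move=> /pinfty_ex_gt0[M M0 UM].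
  (* The solutions have [|xs - q| <= |p - q| < e / 2], hence [|xs - y0| < 3 e / 4]. *)
  exists (e / 4); first by rewrite divr_gt0.
  move=> p q py qy [a _ Ta]; apply: (solvable_of_bounded (M := M) Ta) => x xs Tx xsq _.
  apply: UM; exists xs => //; apply: eU; rewrite -ball_normE /ball_ /= distrC.
  move: py qy xsq (ler_distD q xs y0) (ler_distD y0 p q); rewrite (distrC y0 q).
  move: `|p - y0| `|q - y0| `|xs - q| `|p - q| `|xs - y0| => py qy xq pq xy; lra.
rewrite /op_surjective -subTset => ys _.
have [c [c0 c1 c_cont]] : exists c : R -> dual X, [/\ c 0 = av, c 1 = ys & continuous c].
  exists (fun t => av + t *: (ys - av)); split; first by rewrite scale0r addr0.
    by rewrite scale1r addrCA subrr addr0.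
  move=> t; apply: cvgD; first exact: cvg_cst.
  by apply: cvgZr_tmp; exact: cvg_id.
have c_near t r : 0 < r -> \forall s \near t, `|c s - c t| < r.
  by move=> r0; move/cvgrPdistC_lt : (c_cont t) => /(_ _ r0).
pose B := [set t | op_ran T (c t)].
have B_open : open B.
  rewrite openE => t Bt; have [r r0 rP] := near_ran (c t).
  apply: filterS (c_near t r r0) => s st.
  apply: (rP (c t) (c s) _ st Bt); rewrite subrr normr0; exact: r0.
have B_closed : closed B.
  rewrite -[B]setCK; apply: open_closedC; rewrite openE => t Bt.
  have [r r0 rP] := near_ran (c t).
  apply: filterS (c_near t r r0) => s st Bs; apply: Bt.
  apply: (rP (c s) (c t) st _ Bs); rewrite subrr normr0; exact: r0.
have /connected_intervalP cT : is_interval [set: R] by [].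
have B1 : B = setT.
  apply: cT.
  - by exists 0; rewrite /B /= c0.
  - by exists B => //; rewrite setTI.
  - by exists B => //; rewrite setTI.
have : B 1 by rewrite B1.
by rewrite /B /= c1.
Qed.

(** On the solution set [|xs| <= |ys| + |av - ys|], a bound which coercivity transfers
to [x]. *)
Lemma surjective_of_coercive (S : set X) : op_ran T !=set0 -> op_dom T `<=` S ->
  ereal_inf [set `|xs|%:E | xs in T x] @[x --> norm_pinfty S] --> +oo%E ->
  op_surjective T.
Proof.
move=> [av [a _ Ta]] TS Tco; rewrite /op_surjective -subTset => ys _.
pose r := `|ys| + `|av - ys|.
have [M _ MT] : norm_pinfty S [set x | (r%:E < ereal_inf [set `|xs|%:E | xs in T x])%E].
  apply: (Tco [set z | (r%:E < z)%E]); exists r; split; first exact: num_real.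
  by move=> z.
apply: (solvable_of_bounded (M := M) Ta) => x xs Tx xsy _.
rewrite leNgt; apply/negP => Mx.
have Sx : S x by apply: TS; exists xs.
have := MT x (conj Sx Mx); rewrite /= ltNge => /negP; apply.
apply: (@le_trans _ _ `|xs|%:E).
  by apply: ereal_inf_lbound; exists xs.
rewrite lee_fin /r (le_trans _ (lerD (lexx _) xsy))//.
by rewrite -[X in `|X| <= _](subrKC ys) ler_normD.
Qed.

Lemma surjective_of_bounded_dom (S : set X) : op_ran T !=set0 -> op_dom T `<=` S ->
  bounded_set S -> op_surjective T.
Proof.
move=> [av [a _ Ta]] TS /pinfty_ex_gt0[M _ SM]; rewrite /op_surjective -subTset => ys _.
apply: (solvable_of_bounded (M := M) Ta) => x xs Tx _ _.
by apply: SM; apply: TS; exists xs.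
Qed.

(** Uniform monotonicity against [(a, av)] bounds [phi t / t] for [t = |x - a|] by
[|xs - av|], which is at most [2 |av - ys|] on the solution set. *)
Lemma surjective_of_uniformly_monotone (phi : R -> \bar R) : op_ran T !=set0 ->
  uniformly_monotone_with phi T ->
  (phi t * (t^-1)%:E)%E @[t --> +oo] --> +oo%E ->
  op_surjective T.
Proof.
move=> [av [a _ Ta]] [_ Tphi] phioo; rewrite /op_surjective -subTset => ys _.
pose r := `|av - ys| *+ 2.
have [M [_ MT]] : \forall t \near +oo, (r%:E < phi t * (t^-1)%:E)%E.
  apply: (phioo [set z | (r%:E < z)%E]); exists r; split; first exact: num_real.
  by move=> z.
apply: (solvable_of_bounded (M := Num.max M 0 + `|a|) Ta) => x xs Tx xsy _.
rewrite leNgt; apply/negP => Mx.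
have : Num.max M 0 < `|x - a|.
  by rewrite (lt_le_trans _ (lerB_dist x a))// ltrBrDr.
rewrite gt_max => /andP[Mxa xa0].
have := MT _ Mxa; rewrite ltNge => /negP; apply.
rewrite lee_pdivrMr//; apply: le_trans (Tphi _ _ _ _ Tx Ta) _.
rewrite -EFinM lee_fin (le_trans (pairing_le _ _))// ler_wpM2r// /r mulr2n.
by rewrite (le_trans (ler_distD ys xs av))// (distrC ys) lerD2r.
Qed.

Lemma surjective_of_strongly_monotone (rho : R) : op_ran T !=set0 ->
  strongly_monotone rho T -> op_surjective T.
Proof.
move=> T0 [rho0 Trho]; apply: (surjective_of_uniformly_monotone T0 Trho).
apply/cvgeyPgt => M; near=> t.
have t0 : 0 < t by [].
rewrite -EFinM lte_fin expr2 mulrA mulfK ?gt_eqF// mulrC -ltr_pdivrMr//.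
near: t; exists (M / rho); split; [exact: num_real|by []].
Unshelve. all: end_near. Qed.

(** For a solution, [<p - x, xs - vs> <= C] rearranges into a bound on [<x, vs - ys>] from
above, the regularizing term having a favorable sign. As [vs] is arbitrary, the
solutions are pointwise bounded above on the dual. *)
Lemma surjective_of_bounded_above : op_ran T !=set0 ->
  (forall vs, exists p C, forall x xs, T x xs -> pairing (p - x) (xs - vs) <= C) ->
  op_surjective T.
Proof.
move=> [av [a _ Ta]] TC; rewrite /op_surjective -subTset => ys _.
pose B := [set x | exists xs, [/\ T x xs, `|xs - ys| <= `|av - ys| &
  0 <= pairing (x - a) (ys - xs)]].
have [vs|M BM] := @weakly_bounded_of_bounded_above R X B.
  have [p [C pC]] := TC (vs + ys).
  exists (C + `|p - a| * `|av - ys| + pairing p vs) => x [xs [Tx xsy xa]].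
  have := pC _ _ Tx.
  have : - pairing (p - a) (xs - ys) <= `|p - a| * `|av - ys|.
    rewrite (le_trans (ler_norm _))// normrN (le_trans (le_pairing _ _))// mulrC.
    by rewrite ler_wpM2l.
  move: xa (`|p - a| * `|av - ys|) {xsy} => + K.
  by rewrite !pairingE; lra.
apply: (solvable_of_weakly_bounded (M := M) X_reflexive T_max Ta) => x xs Tx xsy xa.
by apply: BM; exists xs.
Qed.

End surjectivity.

(** * Sums of operators and the Brezis-Haraux condition *)

Section brezis_haraux.
Context {R : realType} {X : normedModType R}.
Implicit Types (A B : X -> set (dual X)).

Lemma dom_harauxP A p us : dom_haraux A (p, us) <->
  exists C, forall x xs, A x xs -> pairing (p - x) (xs - us) <= C.
Proof.
split=> [|[C AC]]; last first.
  apply: (@le_lt_trans _ _ C%:E); last exact: ltry.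
  by apply: ge_ereal_sup => _ [[y ys] /= Ay <-]; rewrite lee_fin AC.
rewrite /dom_haraux /=; case E : (haraux A (p, us)) => [C||] // _; [exists C|exists 0] => x xs Ax;
  rewrite -lee_fin.
  by rewrite -E; apply: ereal_sup_ubound; exists (x, xs).
have : ((pairing (p - x) (xs - us))%:E <= haraux A (p, us))%E.
  by apply: ereal_sup_ubound; exists (x, xs).
by rewrite E.
Qed.

Lemma gra_dom_haraux A p us : op_monotone A -> A p us -> dom_haraux A (p, us).
Proof.
move=> Amon Ap; apply/dom_harauxP; exists 0 => x xs Ax.
by have := Amon _ _ _ _ Ap Ax; rewrite !pairingE; lra.
Qed.

Lemma star3_dom_haraux A p us : star3_monotone A -> op_dom A p -> op_ran A us ->
  dom_haraux A (p, us).
Proof. by move=> [_ Astar] Ap Aus; exact: Astar. Qed.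

(** By the Fenchel-Young inequality, [f p - <p, us> + f^* us] bounds the supremum defining the
Haraux function at [(p, us)]. The subgradient of [f^*] at [us] serves
only to make [f^* us] finite. *)
Lemma subdifferential_dom_haraux (f : X -> \bar R) p us :
  proper_function f -> (exists x, subdifferential f x !=set0) ->
  op_dom (subdifferential f) p ->
  op_dom (subdifferential (fenchel_conjugate f)) us ->
  dom_haraux (subdifferential f) (p, us).
Proof.
move=> [fgt [x0 fx0]] [x [xs fx]] [ps fp] [phi fphi].
have fin y ys : subdifferential f y ys -> f y \is a fin_num.
  move=> fy; rewrite fin_numE gt_eqF//=; apply/eqP => fyoo.
  by have := fy x0; rewrite fyoo addey// leye_eq => /eqP fx0oo; rewrite fx0oo in fx0.
(* A subgradient of [f] makes [f^*] finite somewhere, so that [f^*] is finite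
   wherever it has a subgradient. *)
have conj_le : ((fenchel_conjugate f xs) < +oo)%E.
  apply: (@le_lt_trans _ _ ((pairing x xs)%:E - f x)%E); last first.
    by rewrite -(fineK (fin _ _ fx)) -EFinN -EFinD ltry.
  apply: ge_ereal_sup => _ [y _ <-].
  have := fx y; rewrite -(fineK (fin _ _ fx)).
  have := fgt y; case: (f y) => [r||]//.
    by rewrite -!EFinN -!EFinD !lee_fin !pairingE; lra.
  by rewrite leNye.
have conj_us : (fenchel_conjugate f us < +oo)%E.
  rewrite ltNge leye_eq; apply/negP => /eqP E.
  have := fphi xs; rewrite E addey// leye_eq => /eqP E'.
  by rewrite E' in conj_le.
have conj_ge y : ((pairing y us)%:E - f y <= fenchel_conjugate f us)%E.
  by apply: ereal_sup_ubound; exists y.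
case E : (fenchel_conjugate f us) => [c||] in conj_us conj_ge *; last 2 first.
- by [].
- by have := conj_ge x; rewrite -(fineK (fin _ _ fx)) -EFinN -EFinD leeNy_eq.
apply/dom_harauxP; exists (fine (f p) - pairing p us + c) => y ys fy.
have := fy p; have := conj_ge y.
rewrite -(fineK (fin _ _ fy)) -(fineK (fin _ _ fp)) -EFinN -!EFinD !lee_fin.
by rewrite !pairingE; lra.
Qed.

(** The two supremum bounds add up to one for the sum, which is the hypothesis of
[surjective_of_bounded_above]. *)
Lemma surjective_add (g : R) A B : reflexive_space X ->
  maximally_monotone (op_add B (op_scale g A)) ->
  op_ran (op_add B (op_scale g A)) !=set0 -> 0 < g ->
  (forall vs, exists p w a,
    [/\ w + g *: a = vs, dom_haraux B (p, w) & dom_haraux A (p, a)]) ->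
  op_surjective (op_add B (op_scale g A)).
Proof.
move=> Xrefl Smax S0 g0 H; apply: surjective_of_bounded_above => // vs.
have [p [w [a [<- /dom_harauxP[C BC] /dom_harauxP[C' AC]]]]] := H vs.
exists p, (C + g * C') => x _ [b Bx [_ [c Ax <-] <-]].
rewrite opprD addrACA -scalerBr pairingDr pairingZr lerD ?BC//.
by rewrite ler_pM2l// AC.
Qed.

End brezis_haraux.

(** * Warped resolvents and the two bounds *)

Section warped.
Context {R : realType} {X : normedModType R}.
Context (A : X -> set (dual X)) (D : set X) (W : D -> dual X) (g : R).
Let S := op_add (op_of_map W) (op_scale g A).

Lemma sum_graP u us : S u us <->
  exists2 z : D, \val z = u & exists2 a, A u a & W z + g *: a = us.
Proof.
split=> [[_ [z <- <-] [_ [a Au <-] <-]]|[z <- [a Az <-]]].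
  by exists z => //; exists a.
by exists (W z); [exists z|exists (g *: a) => //; exists a].
Qed.

Lemma op_of_map_dom : op_dom (op_of_map W) = D.
Proof.
apply/seteqP; split=> [_ [_ [z <- _]]|u Du]; first exact/set_mem/valP.
by exists (W (SigSub (mem_set Du))), (SigSub (mem_set Du)).
Qed.

Lemma warped_resolventP (x : D) us u :
  warped_resolvent (op_of_map W) (op_scale g (op_shift A us)) (\val x) u <->
  S u (W x + g *: us).
Proof.
rewrite sum_graP; split.
  move=> [_ [x' /val_inj -> <-] [_ [z <- <-] [_ [_ [a Au <-] <-] E]]].
  by exists z => //; exists a => //; rewrite -E -addrA -scalerDr subrK.
move=> [z <- [a Az E]]; exists (W x); first by exists x.
exists (W z); first by exists z.
exists (g *: (a - us)); first by exists (a - us) => //; exists a.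
by rewrite scalerBr addrA E addrK.
Qed.

(** Two preimages of one value make the pairing of their difference with zero
vanish; in the last case it splits into two nonnegative terms, so that the modulus of [W]
vanishes at the distance of the preimages. *)
Lemma sum_injective :
  [\/ op_injective S, strictly_monotone S |
      uniformly_monotone (op_of_map W) /\ op_monotone A] ->
  0 < g -> op_injective S.
Proof.
case=> [//|[_ Sstrict] _ u v [us [Su Sv]]|[[phi [[phi0 _ phi_eq0] Wphi]] Amon] g0 u v [us []]].
  apply/eqP/negPn/negP => uv; have := Sstrict _ _ _ _ Su Sv uv.
  by rewrite subrr pairing0r ltxx.
move=> /sum_graP[z zu [a Au <-]] /sum_graP[t tv [b Bv /eqP]].
rewrite -subr_eq0 opprD addrACA -scalerBr addr_eq0 => /eqP E.
have Wvu : (phi `|v - u|%R <= (pairing (v - u) (W t - W z))%:E)%E.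
  by apply: Wphi; [exists t|exists z].
have phi_eq : phi `|v - u|%R = 0%E.
  apply/eqP; rewrite eq_le phi0// andbT (le_trans Wvu)// lee_fin E.
  by rewrite pairingNr pairingZr oppr_le0 mulr_ge0 ?(ltW g0)//; exact: Amon.
apply/eqP; rewrite eq_sym -subr_eq0 -normr_eq0; apply/eqP.
exact: (phi_eq0 _ (normr_ge0 _)).1.
Qed.

Theorem haraux_bounds (x z : D) (a us : dual X) (alpha beta : R) :
  0 < g -> 0 < alpha -> 0 < beta -> jointly_strongly_monotone alpha beta W ->
  A (\val z) a -> W z + g *: a = W x + g *: us ->
  ((Num.min alpha beta / 2)%:E * (pair_dist g (op_gra A) (\val x, us)) ^+ 2
       <= (pairing (\val x - \val z) (W x - W z) / g)%:E
       <= haraux A (\val x, us))%E.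
Proof.
move=> g0 alpha0 beta0 Wjsm Az E.
have EW : W x - W z = g *: (a - us).
  by apply/eqP; rewrite subr_eq scalerBr addrAC (addrC (g *: a)) E addrK.
have Wjsm' := Wjsm x z.
apply/andP; split; last first.
  apply: ereal_sup_ubound; exists (\val z, a) => //=.
  by rewrite EW pairingZr mulrAC divff ?gt_eqF// mul1r.
set d := pair_dist _ _ _.
have d0 : (0 <= d)%E.
  by apply: le_ereal_inf_tmp => _ [q _ <-]; rewrite lee_fin sqrtr_ge0.
have dN : (d <= (pair_norm g (\val x - \val z, us - a))%:E)%E.
  by apply: ereal_inf_lbound; exists (\val z, a).
have Nsqr : pair_norm g (\val x - \val z, us - a) ^+ 2 =
    (`|\val x - \val z| ^+ 2 + `|W x - W z| ^+ 2) / g.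
  rewrite sqr_sqrtr/=; last first.
    by rewrite addr_ge0 ?divr_ge0 ?mulr_ge0 ?sqr_ge0// ltW.
  rewrite EW normrZ gtr0_norm// (distrC us) exprMn.
  by field; rewrite gt_eqF.
case: d d0 dN => [r||]//; rewrite !lee_fin => r0 rN.
rewrite -expr2.
have r2 : r ^+ 2 <= pair_norm g (\val x - \val z, us - a) ^+ 2.
  by rewrite ler_pXn2r ?nnegrE// (le_trans r0).
have m0 : 0 <= Num.min alpha beta / 2 by rewrite divr_ge0// le_min !ltW.
apply: le_trans (ler_wpM2l m0 r2) _.
rewrite Nsqr mulrA ler_pM2r ?invr_gt0// mulrDr (le_trans _ Wjsm')// lerD//.
  by rewrite ler_wpM2r ?sqr_ge0// ler_pM2r// ge_min lexx.
by rewrite ler_wpM2r ?sqr_ge0// ler_pM2r// ge_min lexx orbT.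
Qed.

End warped.

Theorem theorem5p19 (R : realType) (X : completeNormedModType R)
    (X_nontrivial : exists e : X, e != 0)
    (X_reflexive : reflexive_space X)
    (A : X -> set (dual X))
    (D : set X) (D_nonempty : D !=set0) (W : D -> dual X)
    (x : D) (us : dual X) (gamma alpha beta : R)
    (gamma_gt0 : 0 < gamma) (alpha_gt0 : 0 < alpha) (beta_gt0 : 0 < beta)
    (D_domA : D `&` op_dom A !=set0)
    (W_jsm : jointly_strongly_monotone alpha beta W) :
  let Wop : X -> set (dual X) := op_of_map W in
  let S : X -> set (dual X) := op_add Wop (op_scale gamma A) in
  [\/ (* E1 *)
      op_ran S (W x + gamma *: us),
      (* E2 *)
      op_surjective S,
      (* E3 *)
      maximally_monotone S /\ (forall ys : dual X, locally_bounded_at (op_inv S) ys) |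
  [\/ (* E4 *)
      maximally_monotone S /\
      (bounded_set (op_dom Wop `&` op_dom A) \/
       (~ bounded_set (op_dom Wop `&` op_dom A) /\
        (ereal_inf [set `|ys|%:E | ys in S y])
          @[y --> norm_pinfty (op_dom Wop `&` op_dom A)] --> +oo%E)),
      (* E5 *)
      maximally_monotone S /\
      (exists2 phi : R -> \bar R, uniformly_monotone_with phi S &
         (phi t * (t^-1)%:E)%E @[t --> +oo] --> +oo%E),
      (* E6 *)
      maximally_monotone S /\ (exists rho : R, strongly_monotone rho S) |
  [\/ (* E7 *)
      [/\ op_monotone Wop /\ op_monotone A, maximally_monotone S,
          mink_add (op_ran Wop) (mink_scale gamma (op_ran A)) = setT &
          [\/ star3_monotone Wop /\ star3_monotone A,
              star3_monotone Wop /\ op_dom A `<=` op_dom Wop |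
              star3_monotone A /\ op_dom Wop `<=` op_dom A]],
      (* E8 *)
      (exists f : X -> \bar R,
        [/\ Gamma0 f /\ Wop = subdifferential f,
            op_monotone A,
            maximally_monotone (op_add (subdifferential f) (op_scale gamma A)),
            mink_add (op_dom (subdifferential (fenchel_conjugate f)))
                     (mink_scale gamma (op_ran A)) = setT &
            op_dom A `<=` op_dom (subdifferential f) \/ star3_monotone A]) |
      (* E9 *)
      [/\ op_monotone Wop, op_monotone A, maximally_monotone S &
          (star3_monotone Wop /\ op_surjective Wop) \/
          (star3_monotone A /\ op_surjective A)]]]] ->
  [\/ op_injective S,
      strictly_monotone S |
      uniformly_monotone Wop /\ op_monotone A] ->
  exists z : D,
    warped_resolvent Wop (op_scale gamma (op_shift A us)) (\val x) = [set \val z] /\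
    ((Num.min alpha beta / 2)%:E * (pair_dist gamma (op_gra A) (\val x, us)) ^+ 2
       <= (pairing (\val x - \val z) (W x - W z) / gamma)%:E
       <= haraux A (\val x, us))%E.
Proof.
move=> Wop S HE HU.
have S_ran0 : op_ran S !=set0.
  have [u [Du [a Au]]] := D_domA.
  pose z : D := SigSub (mem_set Du).
  by exists (W z + gamma *: a), u => //; apply/sum_graP; exists z => //; exists a.
have S_dom : op_dom S `<=` op_dom Wop `&` op_dom A.
  move=> u [s /sum_graP[z zu [a Au _]]].
  by split; [exists (W z), z|exists a].
have S_inj : op_injective S by exact: sum_injective.
suff [u _ Su] : op_ran S (W x + gamma *: us).
  have /sum_graP[z zu [a Az E]] := Su.
  exists z; split; last by rewrite -zu in Az; exact: (@haraux_bounds _ _ A D W gamma x z a).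
  apply/seteqP; split=> [v /warped_resolventP Sv|_ ->].
    by rewrite /= zu; apply: S_inj; exists (W x + gamma *: us).
  by apply/warped_resolventP; rewrite zu.
have surj : op_surjective S -> op_ran S (W x + gamma *: us) by move=> ->.
case: HE => [//|/surj//|[Smax Slb]|].
  by apply: surj; exact: surjective_of_inv_locally_bounded.
case=> [[Smax [Sbd|[_ Sco]]]|[Smax [phi Sphi phioo]]|[Smax [rho Srho]]|].
- by apply: surj; exact: (surjective_of_bounded_dom X_reflexive Smax S_ran0 S_dom).
- by apply: surj; exact: (surjective_of_coercive X_reflexive Smax S_ran0 S_dom).
- by apply: surj; exact: (surjective_of_uniformly_monotone X_reflexive Smax S_ran0 Sphi).
- by apply: surj; exact: (surjective_of_strongly_monotone X_reflexive Smax S_ran0 Srho).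
move=> HBH; apply: surj.
have Smax : maximally_monotone S.
  case: HBH => [[_ +]|[f [[_ +] _ + _ _]]|[_ _ +]] //.
  by rewrite -/Wop /S => ->.
apply: surjective_add => // vs.
have [p0 [Dp0 Ap0]] := D_domA.
have Wp0 : op_dom Wop p0 by rewrite op_of_map_dom.
case: HBH => [[[Wmon Amon] _ ranT H]|[f [[[fprop _ _] Wf] Amon _ ranT H]]|[Wmon Amon _ H]].
- have : (mink_add (op_ran Wop) (mink_scale gamma (op_ran A))) vs by rewrite ranT.
  move=> [w Ww [_ [a Aa <-] <-]].
  case: H => [[W3 A3]|[W3 AW]|[A3 WA]].
  + by exists p0, w, a; split=> //; exact: star3_dom_haraux.
  + have [p _ Ap] := Aa.
    exists p, w, a; split=> //; last exact: gra_dom_haraux.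
    by apply: star3_dom_haraux => //; apply: AW; exists a.
  + have [p _ Wp] := Ww.
    exists p, w, a; split=> //; first exact: gra_dom_haraux.
    by apply: star3_dom_haraux => //; apply: WA; exists w.
- have : (mink_add (op_dom (subdifferential (fenchel_conjugate f)))
      (mink_scale gamma (op_ran A))) vs by rewrite ranT.
  move=> [w fw [_ [a Aa <-] <-]].
  have f0 : exists u, subdifferential f u !=set0 by exists p0; rewrite -Wf.
  rewrite -/Wop Wf; case: H => [Af|A3].
    have [p _ Ap] := Aa.
    exists p, w, a; split=> //; last exact: gra_dom_haraux.
    by apply: subdifferential_dom_haraux => //; apply: Af; exists a.
  exists p0, w, a; split=> //; last exact: star3_dom_haraux.
  by apply: subdifferential_dom_haraux => //; rewrite -Wf.
(* A surjective summand absorbs what the other one leaves, so that the common point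
   [p0] of the domains serves for every value. *)
- case: H => [[W3 Wsurj]|[A3 Asurj]].
    have [a Aa] := Ap0.
    exists p0, (vs - gamma *: a), a; split; first by rewrite subrK.
      by apply: star3_dom_haraux => //; rewrite Wsurj.
    exact: gra_dom_haraux.
  have [w Ww] := Wp0.
  exists p0, w, (gamma^-1 *: (vs - w)); split.
  + by rewrite scalerA divff ?gt_eqF// scale1r addrCA subrr addr0.
  + exact: gra_dom_haraux.
  + by apply: star3_dom_haraux => //; rewrite Asurj.
Qed.
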